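(* Let $n$ be a positive integer and let $\lambda,\mu,\nu$ be partitions such that $\ell(\lambda)\le n$ and $\mu,\nu\subseteq\lambda$ with $|\lambda|=|\mu|+|\nu|$. Let $\rho^\lambda_{\mu,\nu}:\mathcal{LR}(\lambda/\mu,\nu)\to\mathcal{LR}(\lambda/\nu,\mu)$ be the map sending $T$ to its partner tableau $S$. Then $\rho^\lambda_{\mu,\nu}$ is a bijection from $\mathcal{LR}(\lambda/\mu,\nu)$ to $\mathcal{LR}(\lambda/\nu,\mu)$.
   Context: Partitions and tableaux. A partition $\lambda=(\lambda_1\ge\lambda_2\ge\cdots)$ has $\ell(\lambda)$ positive parts and weight $|\lambda|=\sum_i\lambda_i$; trailing zeros may be added. $\mu\subseteq\lambda$ means $\mu_i\le\lambda_i$ for all $i$. $D(\lambda)=\{(i,j):1\le i\le\ell(\lambda),1\le j\le\lambda_i\}$ is its Young diagram, row $i$ counted from the top and column $j$ from the left; a corner is a cell whose removal leaves the Young diagram of a partition. A tableau $T$ of shape $\lambda/\mu$ (outer shape $\lambda$, inner shape $\mu$, $\mu\subseteq\lambda$) is a map $D(\lambda)\setminus D(\mu)\to\{1,2,\dots\}$, extended by $T(i,j)=0$ (''empty cell'') for $(i,j)\in D(\mu)$. Its weight is the sequence whose $s$-th term is the number of entries $s$. $T$ is semistandard if its positive entries weakly increase from left to right along rows and strictly increase down columns. $T$ has the lattice permutation property if for all $r\ge1$, $s\ge2$ the number of entries $s$ in the first $r$ rows is at most the number of entries $s-1$ in the first $r-1$ rows. A Littlewood--Richardson (LR) tableau is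 one that is semistandard and has the lattice permutation property. $\mathcal{LR}(\lambda/\mu,\nu)$ is the set of LR tableaux of shape $\lambda/\mu$ and weight $\nu$. Deletion operators. Let $T$ be an LR tableau of shape $\lambda/\mu$ and $(r,\lambda_r)$ a corner of $D(\lambda)$. The deletion operator $\delta_{r,\lambda_r}$ acts on $T$ as follows. (i) If $T(r,\lambda_r)=r$, the cell $(r,\lambda_r)$ is removed, and the terminating row number is $0$. (ii) If $0<T(r,\lambda_r)<r$, remove the cell $(r,\lambda_r)$ with its entry $c_r$; then for $s=r-1,r-2,\dots$ let $c_{s+1}$ replace the rightmost entry of row $s$ (zeros included) that is strictly less than $c_{s+1}$, and call the replaced entry $c_s$; stop as soon as $c_s=0$. The terminating row number is the row $k=s$ in which this happens; the outer shape loses $(r,\lambda_r)$ and the inner shape loses its corner $(k,\mu_k)$. (iii) If $T(r,\lambda_r)=0$, the cell $(r,\lambda_r)=(r,\mu_r)$ is removed from both outer and inner shapes, and the terminating row number is $r$. Full $r$-deletion. If $T$ is an LR tableau with outer shape $\lambda$ and $\ell(\lambda)=r$, then $\delta_r=\delta_{r,1}\delta_{r,2}\cdots\delta_{r,\lambda_r}$, with $\delta_{r,\lambda_r}$ acting first and $\delta_{r,1}$ last. If $\ell(\lambda)<r$, $\delta_r$ does nothing. Partner tableau. For an LR tableau $T$ with outer shape $\lambda$, $\ell(\lambda)\le n$, set $T^{(n)}=T$ and $T^{(r-1)}=\delta_rT^{(r)}$ for $r=n,n-1,\dots,1$. The partner tableau $S$ of $T$ is the filling of $D(\lambda)$ whose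 row $r$ consists, from left to right, of the $\lambda_r$ terminating row numbers (including zeros) of the operations constituting $\delta_r$ applied to $T^{(r)}$, in order of occurrence; cells containing $0$ are regarded as empty (inner-shape) cells. (For $T\in\mathcal{LR}(\lambda/\mu,\nu)$ it lies in $\mathcal{LR}(\lambda/\nu,\mu)$.) *)

(* Defs.v *)
From mathcomp Require Import all_boot.
From mathcomp Require Import classical_sets functions.

Set Implicit Arguments.
Unset Strict Implicit.
Unset Printing Implicit Defensive.

(* Rows, columns and parts are numbered from 1.  Prepending a dummy item makes
   index 0, like any index past the end, denote a missing part, row or cell. *)

(* A partition is the list of its positive parts, so that its length is its
   [size] and its weight is its [sumn]. *)
Definition is_part (la : seq nat) : bool := sorted geq la && (0 \notin la).

Definition part (la : seq nat) (i : nat) : nat := nth 0 (0 :: la) i.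

Definition part_sub (mu la : seq nat) : Prop :=
  forall i, part mu i <= part la i.

(* A tableau of shape la / mu is the list of the rows of D(la) from top to
   bottom, with entry 0 in the cells of D(mu).  Hence its outer shape is
   [shape T], and its inner shape is formed by its zeros. *)
Definition tableau := seq (seq nat).

Definition row (T : tableau) (i : nat) : seq nat := nth [::] ([::] :: T) i.

(* Cells outside D(la) also read as 0. *)
Definition entry (T : tableau) (i j : nat) : nat := nth 0 (0 :: row T i) j.

Definition has_shape (la mu : seq nat) (T : tableau) : Prop :=
  shape T = la /\
  forall i j, 0 < j <= part la i -> (entry T i j == 0) = (j <= part mu i).

Definition has_weight (nu : seq nat) (T : tableau) : Prop :=
  forall s, 0 < s -> count_mem s (flatten T) = part nu s.

Definition semistandard (T : tableau) : Prop :=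
  (forall i j j', j < j' -> 0 < entry T i j -> 0 < entry T i j' ->
     entry T i j <= entry T i j') /\
  (forall i i' j, i < i' -> 0 < entry T i j -> 0 < entry T i' j ->
     entry T i j < entry T i' j).

Definition lattice_permutation (T : tableau) : Prop :=
  forall r s, 1 <= r -> 2 <= s ->
    count_mem s (flatten (take r T))
      <= count_mem s.-1 (flatten (take r.-1 T)).

Definition LR (la mu nu : seq nat) : set tableau :=
  [set T | [/\ has_shape la mu T, has_weight nu T, semistandard T
             & lattice_permutation T]]%classic.

(* Rows left empty are dropped, so that the outer shape keeps no zero part. *)
Definition remove_cell (r : nat) (T : tableau) : tableau :=
  let w := row T r in
  [seq v <- set_nth [::] T r.-1 (take (size w).-1 w) | ~~ nilp v].

(* Position, counted from 0, of the rightmost entry of w less than c; the value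
   is irrelevant if there is none, which does not happen in an LR tableau. *)
Definition rightmost_lt (c : nat) (w : seq nat) : nat :=
  last 0 [seq j <- iota 0 (size w) | nth 0 w j < c].

(* Insert c (the c_{s+1} of the definition) in row s and carry on upwards.
   Writing over a zero is what takes the corner of row s off the inner shape. *)
Fixpoint bump (s c : nat) (T : tableau) : tableau * nat :=
  if s is s'.+1 then
    let w := row T s in
    let j := rightmost_lt c w in
    let c' := nth 0 w j in
    let T' := set_nth [::] T s' (set_nth 0 w j c) in
    if c' == 0 then (T', s) else bump s' c' T'
  else (T, 0).

(* The result is paired with the terminating row number. *)
Definition delta_cell (r : nat) (T : tableau) : tableau * nat :=
  let c := entry T r (size (row T r)) in
  if c == r then (remove_cell r T, 0)
  else if 0 < c then bump r.-1 c (remove_cell r T)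
  else (remove_cell r T, r).

Fixpoint delta_cells (m r : nat) (T : tableau) : tableau * seq nat :=
  if m is m'.+1 then
    let: (T1, k) := delta_cell r T in
    let: (T2, ks) := delta_cells m' r T1 in
    (T2, k :: ks)
  else (T, [::]).

(* The result is paired with the terminating row numbers, in order. *)
Definition delta (r : nat) (T : tableau) : tableau * seq nat :=
  if size T == r then delta_cells (size (row T r)) r T else (T, [::]).

(* Applied to T^(r), this lists rows 1 to r of the partner tableau. *)
Fixpoint partner_rows (r : nat) (T : tableau) : seq (seq nat) :=
  if r is r'.+1 then
    let: (T', w) := delta r T in rcons (partner_rows r' T') w
  else [::].

(* The rows numbered above the length of la are empty, hence left out. *)
Definition partner (n : nat) (T : tableau) : tableau :=
  take (size T) (partner_rows n T).

(* Main.v *)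
Require Import Defs.
From mathcomp Require Import all_boot.
From mathcomp Require Import classical_sets functions.
From mathcomp Require Import cardinality zify.

(** The partner map is given by one recipe on LR (la / mu, nu) and on
    LR (la / nu, mu).  It therefore suffices to show, for all mu and nu, that it
    sends LR tableaux of shape la / mu and weight nu to LR tableaux of shape
    la / nu and weight mu ([partner_LR]), and that it is injective
    ([partner_inj]): these sets are finite, and injections both ways between
    finite sets are surjective ([finite_inj_surj]).

    Both facts come from reading a full r-deletion row by row.  The bumping
    paths that start from the successive cells of row r pass through row i in
    the order in which they start.  Hence the entries of row r less than r may
    all be inserted in row r-1, as one decreasing word; the word of the replaced
    entries is then inserted in row r-2, and so on ([climbs_sweep]).  Inserting
    a decreasing word in a row is a queue that serves the values from the
    largest down, so it is described by counts ([insert_entriesP]).  Let R t i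
    and R' t i be the numbers of entries at most t in row i before and after the
    deletion, let a t i be the number of entries t in row i before it, and let
    G t i be the number of entries greater than t that are replaced in row i
    (for i = r: of entries of row r that lie strictly between t and r).  Then,
    for i < r,
      G t i  = min (G (t+1) i + a (t+1) i, G (t+1) (i+1)),
      R' t i = R t i + G t i - G t (i+1),
    which is a form of the octahedron recurrence.  A path ends in row t or above
    exactly when the entry that it replaces in row t+1 is not zero, so nu_r +
    G 0 (t+1) of the terminating row numbers are at most t ([deltaP]).

    Everything else follows from this recurrence by induction on t.
    - R t (i+1) <= R' t i ([deletion_interlace]).  Thus the deletion yields an
      LR tableau again ([deletion_filling]); for t = 0 this says that the inner
      shapes interlace, which is the lattice permutation property of the
      partner.
    - For two successive deletions, of rows r+1 and r, with counts G and G1,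
      nu_(r+1) + G t (i+1) <= nu_r + G1 t i ([deletion_compare]).  For t = 0
      this is the strict increase down the columns of the partner.
    - The recurrence can be solved backwards ([deletion_inverse]): from R' and
      G 0, which the shortened tableau and the terminating row numbers provide,
      one recovers G, hence R, hence the tableau ([deletion_inj]). *)

Set Implicit Arguments.
Unset Strict Implicit.
Unset Printing Implicit Defensive.

(** * Bumping paths, one at a time and row by row *)

(** One step of a bumping path.  A path that has replaced a zero is continued as
    the insertion of 0, which changes nothing: all paths then reach row 1, and
    the row in which a path ends is its number of zeros. *)
Definition insert_entry (c : nat) (w : seq nat) : seq nat * nat :=
  if c == 0 then (w, 0)
  else let j := rightmost_lt c w in (set_nth 0 w j c, nth 0 w j).

Fixpoint insert_entries (xs w : seq nat) : seq nat * seq nat :=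
  if xs is x :: xs' then
    let: (w1, y) := insert_entry x w in
    let: (w2, ys) := insert_entries xs' w1 in (w2, y :: ys)
  else (w, [::]).

(** Returns the rows after the path and the list of the entries on the path,
    indexed by rows from the top, with the starting entry c in last place. *)
Fixpoint climb (c : nat) (U : tableau) : tableau * seq nat :=
  if U is w :: U' then
    let: (U1, cs) := climb c U' in
    let: (w1, y) := insert_entry (head 0 cs) w in (w1 :: U1, y :: cs)
  else ([::], [:: c]).

Fixpoint climbs (xs : seq nat) (U : tableau) : tableau * seq (seq nat) :=
  if xs is x :: xs' then
    let: (U1, cs) := climb x U in
    let: (U2, css) := climbs xs' U1 in (U2, cs :: css)
  else (U, [::]).

(** The i-th word of the second component consists of the entries replaced in
    the i-th row; the word in last place is the input xs. *)
Fixpoint sweep (xs : seq nat) (U : tableau) : tableau * seq (seq nat) :=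
  if U is w :: U' then
    let: (U1, yss) := sweep xs U' in
    let: (w1, ys) := insert_entries (head [::] yss) w in (w1 :: U1, ys :: yss)
  else ([::], [:: xs]).

Lemma rightmost_lt_size c w : w != [::] -> rightmost_lt c w < size w.
Proof.
move=> w0; rewrite /rightmost_lt.
set s := [seq _ <- _ | _].
have: last 0 s \in 0 :: s by apply: mem_last.
rewrite inE => /orP[/eqP->|]; first by case: w w0 {s}.
by rewrite mem_filter mem_iota => /andP[_ /andP[]].
Qed.

Lemma size_insert_entry c w :
  w != [::] -> size (insert_entry c w).1 = size w.
Proof.
move=> w0; rewrite /insert_entry; case: eqP => //= _.
by rewrite size_set_nth; apply/maxn_idPr; apply: rightmost_lt_size.
Qed.

Lemma climb_rcons c U w :
  climb c (rcons U w) =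
  let: (w1, y) := insert_entry c w in
  let: (U1, cs) := climb y U in (rcons U1 w1, rcons cs c).
Proof.
elim: U => [|u U IH] /=; first by case: (insert_entry c w).
rewrite IH; case: (insert_entry c w) => w1 y.
have: (climb y U).2 != [::].
  by case: U {IH} => //= a U; case: (climb y U) => ? ?; case: insert_entry.
case: (climb y U) => U1 [|z cs] //= _.
by case: insert_entry.
Qed.

Lemma climb0 U : climb 0 U = (U, nseq (size U).+1 0).
Proof. by elim: U => //= w U ->. Qed.

Lemma shape_climb c U :
  [::] \notin U -> shape (climb c U).1 = shape U.
Proof.
elim: U => //= w U IH; rewrite inE negb_or eq_sym => /andP[w0 /IH].
case: (climb c U) => U1 cs /= sU.
have := size_insert_entry (head 0 cs) w0.
by case: insert_entry => /= ? ? ->; rewrite sU.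
Qed.

Lemma size_climb c U : size (climb c U).2 = (size U).+1.
Proof.
elim: U => //= w U; case: (climb c U) => U1 cs /=.
by case: insert_entry => ? ? /= ->.
Qed.

Lemma row_cat_last U w V : row (rcons U w ++ V) (size U).+1 = w.
Proof. by rewrite /row /= nth_cat size_rcons ltnSn nth_rcons ltnn eqxx. Qed.

Lemma set_nth_cat_last (U : tableau) w w' V :
  set_nth [::] (rcons U w ++ V) (size U) w' = rcons U w' ++ V.
Proof. by elim: U => //= u U ->. Qed.

(** The zeros of a path fill its rows from the one in which it ends up to
    row 1, so they are as many as the number of that row. *)
Lemma bump_climb c U V : 0 < c ->
  Defs.bump (size U) c (U ++ V) =
  let: (U1, cs) := climb c U in (U1 ++ V, count_mem 0 cs).
Proof.
elim/last_ind: U c V => [|U w IH] c V c0 /=; first by case: c c0.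
rewrite climb_rcons size_rcons /insert_entry (gtn_eqF c0).
cbn [Defs.bump].
have count_c s : count_mem 0 (rcons s c) = count_mem 0 s.
  by rewrite -cats1 count_cat /= (gtn_eqF c0) !addn0.
rewrite row_cat_last set_nth_cat_last.
case: eqP => [y0|/eqP y0].
  by rewrite y0 climb0 count_c count_nseq mul1n.
rewrite cat_rcons IH ?lt0n //; case: climb => U1 cs.
by rewrite cat_rcons count_c.
Qed.

(** Row r in the course of its deletion: once empty it is no longer listed. *)
Definition add_row (U : tableau) (v : seq nat) : tableau :=
  U ++ [seq w <- [:: v] | ~~ nilp w].

Lemma remove_cell_rcons U v c : [::] \notin U ->
  remove_cell (size U).+1 (rcons U (rcons v c)) = add_row U v.
Proof.
move=> U0; rewrite /remove_cell -(cats0 (rcons U _)) row_cat_last.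
rewrite set_nth_cat_last size_rcons /= -(cats1 v) take_size_cat // cats0.
rewrite -cats1 filter_cat (_ : [seq v0 <- U | _] = U) //.
by apply/all_filterP/allP => u uU; apply: contra U0 => /nilP <-.
Qed.

Lemma delta_cell_climb U v c : [::] \notin U ->
  delta_cell (size U).+1 (rcons U (rcons v c)) =
  if c == (size U).+1 then (add_row U v, 0)
  else let: (U1, cs) := climb c U in (add_row U1 v, count_mem 0 cs).
Proof.
move=> U0; rewrite /delta_cell remove_cell_rcons //.
rewrite -[rcons U _]cats0 /entry row_cat_last size_rcons /= nth_rcons ltnn eqxx.
case: eqP => // _; case: (posnP c) => [->|c0].
  by rewrite climb0 count_nseq mul1n.
by rewrite /add_row bump_climb.
Qed.

Lemma no_nil_shape (U V : tableau) :
  shape U = shape V -> ([::] \in U) = ([::] \in V).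
Proof.
elim: U V => [|u U IH] [|v V] //= [uv /IH e]; rewrite !inE e; congr (_ || _).
by case: u v uv => [|? ?] [|? ?].
Qed.

(** Let r be (size U).+1.  The entries r of row r are only removed; as they
    stand at the right end of the row, they come first and record the leading
    zeros. *)
Lemma delta_cells_climbs U v : [::] \notin U -> sorted leq v ->
  all (fun x => x <= (size U).+1) v ->
  delta_cells (size v) (size U).+1 (add_row U v) =
  let: (U1, css) := climbs (rev [seq x <- v | x < (size U).+1]) U in
  (U1, nseq (count_mem (size U).+1 v) 0 ++ [seq count_mem 0 cs | cs <- css]).
Proof.
elim/last_ind: v U => [|v c IH] U U0 sv bv.
  by rewrite /add_row /= cats0.
have svv : sorted leq v by move: (sv); rewrite -cats1 => /cat_sorted2[].
have vc : all (leq^~ c) v.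
  by move: sv; rewrite (sorted_pairwise leq_trans) pairwise_rcons => /andP[].
move: bv; rewrite all_rcons => /andP[cr bv].
rewrite size_rcons [delta_cells _ _ _]/=.
have -> : add_row U (rcons v c) = rcons U (rcons v c).
  by rewrite /add_row /= (_ : nilp _ = false) ?cats1 //; case: (v).
rewrite delta_cell_climb // filter_rcons.
rewrite -[count_mem _ (rcons v c)]size_filter filter_rcons.
case: eqP => [cE|/eqP cE].
  have -> : c < (size U).+1 = false by rewrite cE ltnn.
  rewrite /= cE eqxx IH // size_rcons size_filter.
  by case: climbs.
have cr' : c < (size U).+1 by rewrite ltn_neqAle cE.
have cnt : count_mem (size U).+1 v = 0.
  apply/eqP; rewrite -leqn0 leqNgt -has_count; apply/hasPn => x /(allP vc) le_xc.
  by rewrite /= ltn_eqF // (leq_ltn_trans le_xc).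
rewrite cr' rev_rcons /= (negbTE cE) size_filter cnt /=.
have := shape_climb c U0; case: (climb c U) => U1 cs /= sU.
have eU : size U1 = size U by rewrite -(size_map size U) -/(shape _) -sU size_map.
rewrite -eU IH ?(no_nil_shape sU) ?eU //.
by case: climbs => U2 css; rewrite cnt.
Qed.

Lemma delta_climbs U v : [::] \notin U -> v != [::] -> sorted leq v ->
  all (fun x => x <= (size U).+1) v ->
  delta (size U).+1 (rcons U v) =
  let: (U1, css) := climbs (rev [seq x <- v | x < (size U).+1]) U in
  (U1, nseq (count_mem (size U).+1 v) 0 ++ [seq count_mem 0 cs | cs <- css]).
Proof.
move=> U0 v0 sv bv; rewrite /delta size_rcons eqxx.
rewrite -{1}(cats0 (rcons _ _)) row_cat_last.
rewrite -delta_cells_climbs //; congr delta_cells.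
by rewrite /add_row /=; case: v v0 {sv bv} => //= a v _; rewrite cats1.
Qed.

(** The top row does not influence the part of the paths below it, so it can be
    treated after all of them are known. *)
Lemma climbs_cons xs w U :
  climbs xs (w :: U) =
  let: (U1, css) := climbs xs U in
  let: (w1, ys) := insert_entries [seq head 0 cs | cs <- css] w in
  (w1 :: U1, [seq p.1 :: p.2 | p <- zip ys css]).
Proof.
elim: xs w U => //= x xs IH w U.
case: (climb x U) => U1 cs /=.
case E: (insert_entry _ w) => [w1 y]; rewrite IH.
case: climbs => U2 css /=; rewrite E.
by case: insert_entries.
Qed.

Lemma size_climbs xs U : size (climbs xs U).2 = size xs.
Proof.
elim: xs U => //= x xs IH U; case: climb => U1 cs /=.
by have := IH U1; case: climbs => ? ? /= ->.
Qed.

Lemma size_insert_entries xs w : size (insert_entries xs w).2 = size xs.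
Proof.
elim: xs w => //= x xs IH w; case: insert_entry => w1 y.
by have := IH w1; case: insert_entries => ? ? /= ->.
Qed.

Lemma sweep_head xs U :
  (sweep xs U).2 = nth [::] (sweep xs U).2 0 :: behead (sweep xs U).2.
Proof. by case: U => //= w U; case: sweep => ? ?; case: insert_entries. Qed.

(** The two orders of the insertions fill the same array, by columns (one per
    path) and by rows, since the step of a path in a row depends only on the
    step of that path in the row below and on the earlier steps in that row. *)
Lemma climbs_sweep xs U :
  [/\ (climbs xs U).1 = (sweep xs U).1,
      size (sweep xs U).2 = (size U).+1 &
      forall i, i <= size U -> nth [::] (sweep xs U).2 i =
        [seq nth 0 cs i | cs <- (climbs xs U).2]].
Proof.
elim: U => [|w U [IH1 IH2 IH3]].
  have -> : climbs xs [::] = ([::], [seq [:: x] | x <- xs]).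
    by elim: xs => //= x xs ->.
  split=> //= [] [|i] // _; rewrite -map_comp /=.
  by elim: (xs) => //= x s <-.
rewrite climbs_cons /=.
have := sweep_head xs U; have := size_climbs xs U.
case: sweep IH1 IH2 IH3 => S1 yss /=; case: climbs => U1 css /= <- IH2 IH3 szc yE.
have hd : head [::] yss = [seq head 0 cs | cs <- css].
  rewrite -nth0 IH3 //; apply: eq_map => cs; exact: nth0.
rewrite hd; have := size_insert_entries [seq head 0 cs | cs <- css] w.
case: insert_entries => w1 ys /=; rewrite size_map => sy; split=> //=.
  by rewrite IH2.
case=> [|i] le_i /=.
  rewrite -map_comp -[RHS]/(unzip1 _) unzip1_zip // sy //.
rewrite IH3 // -{1}(@unzip2_zip _ _ ys css) ?sy // /unzip2 -!map_comp //.
Qed.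

(** * Inserting a decreasing word in a row *)

Definition nb_le (t : nat) (w : seq nat) : nat := count (fun x => x <= t) w.
Definition nb_gt (t : nat) (w : seq nat) : nat := count (fun x => t < x) w.
Definition nb_eq (t : nat) (w : seq nat) : nat := count_mem t w.

Lemma nb_le_gt t w : nb_le t w + nb_gt t w = size w.
Proof.
rewrite -(count_predC (fun x => x <= t) w); congr (_ + _).
by apply: eq_count => x /=; rewrite -ltnNge.
Qed.

Lemma nb_leS t w : nb_le t.+1 w = nb_le t w + nb_eq t.+1 w.
Proof. by elim: w => //= a w; rewrite /nb_le /nb_eq /=; lia. Qed.

Lemma nb_le0 w : nb_le 0 w = nb_eq 0 w.
Proof. by apply: eq_count => x; rewrite leqn0. Qed.

Lemma nb_gt0_all t w : (nb_gt t w == 0) = all (fun x => x <= t) w.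
Proof.
rewrite /nb_gt -leqn0 leqNgt -has_count -all_predC.
by apply: eq_all => x /=; rewrite -leqNgt.
Qed.

Lemma nb_le_all t w : (nb_le t w == size w) = all (fun x => x <= t) w.
Proof. by rewrite -nb_gt0_all -(nb_le_gt t w); lia. Qed.

Lemma nb_le_none t w : all (fun x => t < x) w -> nb_le t w = 0.
Proof.
move=> h; apply/eqP; rewrite -leqn0 leqNgt -has_count; apply/hasPn => x.
by move=> /(allP h); rewrite -ltnNge.
Qed.

Lemma split_lt c w : sorted leq w -> exists w1 w2,
  [/\ w = w1 ++ w2, all (fun x => x < c) w1 & all (fun x => c <= x) w2].
Proof.
elim: w => [|a w IH] s; first by exists [::], [::].
case: (ltnP a c) => ac.
  have [w1 [w2 [-> h1 h2]]] := IH (path_sorted s).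
  by exists (a :: w1), w2; rewrite /= ac.
exists [::], (a :: w); split=> //=; rewrite ac /=.
move: s; rewrite /= (path_sortedE leq_trans) => /andP[/allP h _].
by apply/allP => x /h; apply: leq_trans.
Qed.

Lemma rightmost_lt_cat c w1 w2 : all (fun x => x < c) w1 ->
  all (fun x => c <= x) w2 -> rightmost_lt c (w1 ++ w2) = (size w1).-1.
Proof.
move=> h1 h2; rewrite /rightmost_lt size_cat iotaD filter_cat add0n.
rewrite (_ : [seq _ <- iota 0 _ | _] = iota 0 (size w1)); last first.
  apply/all_filterP/allP => j; rewrite mem_iota => /andP[_ lt_j].
  by rewrite nth_cat lt_j; apply: (allP h1); apply: mem_nth.
rewrite (_ : [seq _ <- iota (size w1) _ | _] = [::]); last first.
  rewrite -(filter_pred0 (iota (size w1) (size w2))); apply: eq_in_filter => j.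
  rewrite mem_iota nth_cat => /andP[le_j lt_j].
  rewrite (ltnNge j (size w1)) le_j /=; apply/negbTE; rewrite -leqNgt.
  by apply: (allP h2); apply: mem_nth; rewrite ltn_subLR.
rewrite cats0; case: (size w1) => [|n] //=.
by rewrite (last_nth 0) size_iota -[_ :: _]/(iota 0 n.+1) nth_iota.
Qed.

Lemma insert_entryP c w : sorted leq w -> 0 < c -> 0 < nb_le c.-1 w ->
  exists w1 y w2, [/\ w = w1 ++ y :: w2, insert_entry c w = (w1 ++ c :: w2, y),
    all (fun x => x <= y) w1, y < c & all (fun x => c <= x) w2].
Proof.
move=> sw c0 lt_c; have [w1 [w2 [wE h1 h2]]] := split_lt c sw.
case/lastP: w1 wE h1 => [|w1 y] wE.
  move: lt_c; rewrite wE nb_le_none //.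
  by apply: sub_all h2 => x; rewrite -{1}(prednK c0).
rewrite all_rcons => /andP[yc h1].
exists w1, y, w2; rewrite -cat_rcons; split=> //.
  rewrite /insert_entry gtn_eqF // wE rightmost_lt_cat ?all_rcons ?yc //.
  rewrite size_rcons /= nth_cat size_rcons ltnSn nth_rcons ltnn eqxx.
  by congr (_, _); rewrite !cat_rcons; elim: (w1) => //= a s ->.
move: sw; rewrite wE (sorted_pairwise leq_trans) pairwise_cat pairwise_rcons.
by case/and3P=> _ /andP[].
Qed.

(** The counts that govern the insertion of a decreasing word xs in a row w,
    which becomes w' and gives out ys.  Read the values from the largest down:
    when value t+1 is reached, nb_gt t.+1 xs - nb_gt t.+1 ys inserted entries
    still wait for a smaller entry to replace, and as many entries t+1 of w are
    replaced as there are entries waiting or entries t+1, whichever is less.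
    This is [ri_min], with nb_le t w added to both sides to avoid a
    subtraction. *)
Record row_insertion (xs w w' ys : seq nat) : Prop := RowInsertion {
  ri_size : size w' = size w;
  ri_sorted : sorted leq w';
  ri_out_sorted : sorted geq ys;
  ri_le : forall t, nb_gt t ys <= nb_gt t xs;
  ri_conserve : forall t, nb_le t w' + nb_gt t xs = nb_le t w + nb_gt t ys;
  ri_min : forall t, nb_gt t ys + nb_le t w =
    minn (nb_gt t.+1 ys + nb_le t.+1 w) (nb_gt t.+1 xs + nb_le t w) }.

Lemma geq_trans : transitive geq.
Proof. by move=> y x z /= xy yz; apply: leq_trans yz xy. Qed.

Lemma nb_le_homo t t' w : t <= t' -> nb_le t w <= nb_le t' w.
Proof. by move=> tt; apply: sub_count => x /= /leq_trans; apply. Qed.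

(** The hypothesis on counts is a Hall condition: the positive entries of xs at
    most t+1 do not outnumber the entries of w at most t.  Inserting the largest
    entry x in place of y preserves it, because no entry of w lies strictly
    between y and x. *)
Lemma insert_entriesP xs w : sorted geq xs -> sorted leq w ->
  (forall t, nb_gt 0 xs <= nb_gt t.+1 xs + nb_le t w) ->
  row_insertion xs w (insert_entries xs w).1 (insert_entries xs w).2.
Proof.
elim: xs w => [|x xs IH] w sx sw K.
  split=> //= t; have := nb_le_homo w (leqnSn t); rewrite /nb_gt /=; lia.
have sx' : sorted geq xs by apply: path_sorted sx.
have xx : all (fun z => z <= x) xs.
  by move: sx; rewrite /= (path_sortedE geq_trans) => /andP[].
have Z t : x <= t -> nb_gt t xs = 0.
  move=> xt; apply/eqP; rewrite nb_gt0_all.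
  by apply: sub_all xx => z /= /leq_trans->.
have cE t s : nb_gt t (x :: s) = (t < x) + nb_gt t s by [].
case: (posnP x) => [x0|x0].
  have := IH w sx' sw; rewrite /= /insert_entry x0 eqxx.
  case: insert_entries => w' ys /= [].
    by move=> t; rewrite Z // x0.
  move=> h1 h2 h4 h5 h6 h7; split=> //=; rewrite (path_sortedE geq_trans) h4 andbT.
  by have := h5 0; rewrite Z ?x0 // leqn0 nb_gt0_all.
have Kx t : x.-1 <= t -> nb_gt 0 xs < nb_le t w.
  move=> le_t; have := K t; rewrite !cE x0 (Z t.+1); lia.
have lt_x : 0 < nb_le x.-1 w by apply: leq_trans (Kx _ (leqnn _)).
have [w1 [y [w2 [wE iE h1 yx h2]]]] := insert_entryP sw x0 lt_x.
have L1 t : y <= t -> nb_le t w1 = size w1.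
  move=> yt; apply/eqP; rewrite nb_le_all.
  by apply: sub_all h1 => z /= /leq_trans->.
have L2 t : t < x -> nb_le t w2 = 0.
  by move=> tx; apply: nb_le_none; apply: sub_all h2 => z; apply: leq_trans.
have Lw t : nb_le t w = nb_le t w1 + (y <= t) + nb_le t w2.
  by rewrite wE /nb_le count_cat /= addnA.
pose v := w1 ++ x :: w2.
have Lv t : nb_le t v = nb_le t w1 + (x <= t) + nb_le t w2.
  by rewrite /v /nb_le count_cat /= addnA.
have sv : sorted leq v.
  move: sw; rewrite wE /v !(sorted_pairwise leq_trans) !pairwise_cat /=.
  case/and4P=> /allrelP a1 -> _ ->; rewrite /= h2 !andbT; apply/allrelP => u z uw.
  rewrite inE => /orP[/eqP->|zw].
    by have /(_ u uw) := allP h1; lia.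
  by apply: a1; rewrite ?inE ?zw ?orbT.
have sz : size v = size w by rewrite wE !size_cat.
have := IH v sx' sv; rewrite /= iE -/v.
case: insert_entries => w' ys /= [].
  clear -x0 yx Z L1 L2 Lw Lv Kx K cE; move=> t; have := K t; rewrite !cE x0 Lw Lv.
  case: (ltnP t y) => ty; first lia.
  have := Kx t; have := L1 _ ty; have := Kx x.-1 (leqnn _); rewrite !Lw !L1 //; try lia.
  have := L2 t; have := L2 x.-1; lia.
move=> h3 h4 h6 h7 h8 h9; split=> //; first by rewrite /= h3.
- rewrite /= (path_sortedE geq_trans) h6 andbT.
  suff: nb_gt y ys == 0 by rewrite nb_gt0_all.
  clear -x0 yx Z L1 L2 Lw Lv h7 h8 h9.
  (* no later entry finds a value above y left to replace *)
  have: forall k, y <= x.-1 - k -> nb_gt (x.-1 - k) ys = 0.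
    elim=> [_|k IHk yk].
      by rewrite subn0; have := h9 x.-1; rewrite (Z x.-1.+1) ?prednK //; lia.
    case: (leqP x.-1 k) => kx.
      by rewrite (_ : _ - _ = x.-1 - k) ?IHk; lia.
    have := IHk; have := h9 (x.-1 - k.+1).
    rewrite (_ : (x.-1 - k.+1).+1 = x.-1 - k); last lia.
    rewrite !Lv !L1 ?L2; lia.
  move=> /(_ (x.-1 - y)); rewrite subKn; last lia.
  by move=> /(_ (leqnn _)) /eqP.
- clear -x0 yx Z L1 L2 Lw Lv h7 h8 h9; move=> t; have := h7 t.
  rewrite /nb_gt /= -!/(nb_gt _ _); lia.
- clear -x0 yx Z L1 L2 Lw Lv h7 h8 h9; move=> t; have := h8 t.
  rewrite Lw Lv /nb_gt /= -!/(nb_gt _ _); lia.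
clear -x0 yx Z L1 L2 Lw Lv h7 h8 h9; move=> t; have := h9 t; have := h7 t.+1.
rewrite !Lw !Lv /nb_gt /= -!/(nb_gt _ _).
case: (ltnP t y) => ty.
  have /eqP -> : ((x <= t) == false) by apply/eqP; lia.
  case: (ltnP t.+1 y) => ty'; lia.
rewrite (L1 t) // (L1 t.+1) //; last lia.
case: (ltnP t x) => tx; last first.
  rewrite (Z t.+1) //; last lia.
  have := h7 t; rewrite Z //; lia.
rewrite (L2 t tx); case: (ltnP t.+1 x) => tx'; first by rewrite (L2 _ tx'); lia.
rewrite (Z t.+1) //; lia.
Qed.

(** * Full deletions in terms of counts *)

Definition nb_in (T : tableau) (s i : nat) : nat :=
  count_mem s (flatten (take i T)).

(** LR tableaux, shape and weight apart, in terms of counts.  The entries at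
    most t+1 of a row lie under the entries at most t of the row above; this is
    the strict increase down the columns.  The zeros are treated apart, as a
    zero may lie under a zero. *)
Record LR_filling (T : tableau) : Prop := LRFilling {
  filling_nonempty : [::] \notin T;
  filling_sorted : forall i, sorted leq (row T i);
  filling_bound : forall i, all (fun x => x <= i) (row T i);
  filling_inner : forall i, 0 < i -> nb_le 0 (row T i.+1) <= nb_le 0 (row T i);
  filling_column : forall i t, 0 < i ->
    nb_le t.+1 (row T i.+1) <= nb_le t (row T i);
  filling_lattice : forall s i, 0 < s -> nb_in T s.+1 i.+1 <= nb_in T s i }.

(** The effect of the deletion of row r+1 of T, with outcome T' and terminating
    row numbers ks.  G t i is the number of entries greater than t that are
    replaced in row i and then inserted in row i-1; the word that enters row r
    consists of the entries of row r+1 less than r+1. *)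
Record deletion (r : nat) (T T' : tableau) (ks : seq nat)
    (G : nat -> nat -> nat) : Prop := Deletion {
  del_source_size : size T = r.+1;
  del_size : size T' = r;
  del_row_size : forall i, 0 < i <= r -> size (row T' i) = size (row T i);
  del_sorted : forall i, sorted leq (row T' i);
  del_anti : forall i t, G t.+1 i <= G t i;
  del_le : forall i t, 0 < i <= r -> G t i <= G t i.+1;
  del_conserve : forall i t, 0 < i <= r ->
    nb_le t (row T' i) + G t i.+1 = nb_le t (row T i) + G t i;
  del_min : forall i t, 0 < i <= r -> G t i + nb_le t (row T i) =
    minn (G t.+1 i + nb_le t.+1 (row T i)) (G t.+1 i.+1 + nb_le t (row T i));
  del_last : forall t, t <= r ->
    G t r.+1 + nb_le t (row T r.+1) = nb_le r (row T r.+1);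
  del_last0 : forall t, r <= t -> G t r.+1 = 0;
  del_out_size : size ks = size (row T r.+1);
  del_out_sorted : sorted leq ks;
  del_out_bound : all (fun k => k <= r.+1) ks;
  del_out : forall t, t <= r ->
    nb_le t ks = nb_eq r.+1 (row T r.+1) + G 0 t.+1 }.

Lemma sweep_last xs U :
  size (sweep xs U).1 = size U /\ nth [::] (sweep xs U).2 (size U) = xs.
Proof.
elim: U => [|w U [IH1 IH2]] //=.
by case: sweep IH1 IH2 => S1 yss /= <- ?; case: insert_entries.
Qed.

(** What a row gives out it contained before, value by value. *)
Lemma row_insertion_mono xs w w' ys t t' : row_insertion xs w w' ys ->
  t <= t' -> nb_gt t ys + nb_le t w <= nb_gt t' ys + nb_le t' w.
Proof.
move=> ri /subnK <-; elim: (t' - t) => // k IH.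
by apply: leq_trans IH _; rewrite (ri_min ri) geq_minl.
Qed.

Lemma row_rcons U v i : row (rcons U v) i =
  if i <= size U then row U i else if i == (size U).+1 then v else [::].
Proof. by case: i => [|i] //; rewrite /row /= nth_rcons eqSS. Qed.

(** In a list of entries from the top row down, zeros come first. *)
Definition tail_zero (a b : nat) := (a != 0) ==> (b != 0).

Lemma tail_zero_trans : transitive tail_zero.
Proof. by move=> y x z /implyP xy /implyP yz; apply/implyP => /xy /yz. Qed.

Lemma climb_tail_zero c U : sorted tail_zero (climb c U).2.
Proof.
elim: U => //= w U; case: climb => U1 [|a cs] /=; first by case: insert_entry.
rewrite /insert_entry; case: eqP => [->|/eqP a0] /= -> //.
by rewrite /tail_zero a0 implybT.
Qed.

Lemma size_climb1 c U : size (climb c U).1 = size U.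
Proof.
elim: U => //= w U; case: (climb c U) => U1 cs /=.
by case: insert_entry => ? ? /= ->.
Qed.

Lemma climbs_mem xs U cs : cs \in (climbs xs U).2 ->
  size cs = (size U).+1 /\ sorted tail_zero cs.
Proof.
elim: xs U => //= x xs IH U.
have := size_climb x U; have := size_climb1 x U; have := climb_tail_zero x U.
case: climb => U1 c1 /= h1 h2 h3; have := IH U1; rewrite h2.
case: climbs => U2 css /= h; rewrite inE => /orP[/eqP->|/h] //.
Qed.

Lemma count0_leq cs t : sorted tail_zero cs -> t < size cs ->
  (count_mem 0 cs <= t) = (0 < nth 0 cs t).
Proof.
elim: cs t => //= y cs IH t pcs; case: (posnP y) => [->|y0] lt_t /=.
  by case: t lt_t => //= t lt_t; rewrite add1n ltnS IH // (path_sorted pcs).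
have all0 : all (fun z => 0 < z) cs.
  move: pcs; rewrite (path_sortedE tail_zero_trans) => /andP[+ _].
  by apply: sub_all => z; rewrite /tail_zero -!lt0n y0.
rewrite (_ : count_mem 0 cs = 0); last first.
  apply/eqP; rewrite -leqn0 leqNgt -has_count; apply/hasPn => z /(allP all0) /=.
  by rewrite lt0n.
case: t lt_t => [|t] lt_t /=; rewrite ?y0 //; symmetry.
by apply: (allP all0); apply: mem_nth.
Qed.

(** What is inserted in a row was in the row below, so the strict increase down
    the columns provides the condition of [insert_entriesP] in every row. *)
Lemma sweep_insertion xs U : sorted geq xs ->
  (forall w, w \in U -> sorted leq w) ->
  (forall i t, i.+1 < size U ->
     nb_le t.+1 (nth [::] U i.+1) <= nb_le t (nth [::] U i)) ->
  (forall t, nb_gt 0 xs <= nb_gt t.+1 xs + nb_le t (last [::] U)) ->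
  forall i, i < size U ->
    row_insertion (nth [::] (sweep xs U).2 i.+1) (nth [::] U i)
                  (nth [::] (sweep xs U).1 i) (nth [::] (sweep xs U).2 i).
Proof.
move=> sx; elim: U => //= w U IH sU cU lU.
have sw : sorted leq w by apply: sU; rewrite inE eqxx.
have {}IH : forall i, i < size U -> row_insertion (nth [::] (sweep xs U).2 i.+1)
    (nth [::] U i) (nth [::] (sweep xs U).1 i) (nth [::] (sweep xs U).2 i).
  case: U lU cU IH sU => //= u U lU cU IH sU.
  apply: IH => // [v vU|i t]; last exact: (cU i.+1 t).
  by apply: sU; rewrite inE vU orbT.
have : row_insertion (head [::] (sweep xs U).2) w
  (insert_entries (head [::] (sweep xs U).2) w).1
  (insert_entries (head [::] (sweep xs U).2) w).2.
  apply: insert_entriesP => //.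
    case: U IH {cU lU sU} => [//|u U] IH.
    by have := ri_out_sorted (IH 0 isT); rewrite nth0.
  case: U IH cU lU {sU} => [//|u U] IH cU lU t.
  have := row_insertion_mono (IH 0 isT) (leq0n t.+1); rewrite nth0 /=.
  have := cU 0 t isT; rewrite /=; lia.
have := sweep_head xs U; case: sweep IH => U1 [|y0 yss] //= IH _.
by case: insert_entries => w1 ys /= ri0 [|i] lt_i //=; apply: IH.
Qed.

(** The recurrence is [sweep_insertion].  Later paths stay weakly to the left:
    their entries weakly decrease, so they have at least as many zeros, and the
    terminating row numbers weakly increase. *)
Lemma deltaP T r : LR_filling T -> size T = r.+1 ->
  exists G, deletion r T (delta r.+1 T).1 (delta r.+1 T).2 G.
Proof.
case/lastP: T => // U v gT; rewrite size_rcons => -[rE].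
have rU i : i <= r -> row (rcons U v) i = row U i by rewrite row_rcons rE => ->.
have rv : row (rcons U v) r.+1 = v by rewrite row_rcons rE ltnn eqxx.
have U0 : [::] \notin U.
  by apply: contra (filling_nonempty gT) => U0; rewrite mem_rcons inE U0 orbT.
have v0 : v != [::].
  by apply: contraNneq (filling_nonempty gT) => <-; rewrite mem_rcons inE eqxx.
have sv : sorted leq v by rewrite -rv; apply: filling_sorted.
have bv : all (fun x => x <= r.+1) v by rewrite -rv; apply: filling_bound.
have := delta_climbs U0 v0 sv; rewrite rE => /(_ bv) ->.
set xs := rev _; have xsE t : nb_gt t xs = count (fun x => t < x <= r) v.
  by rewrite /nb_gt count_rev count_filter; apply: eq_count => x /=; rewrite ltnS.
have sxs : sorted geq xs.
  by rewrite rev_sorted; apply: sorted_filter => //; apply: leq_trans.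
have xs_le t : t <= r -> nb_gt t xs + nb_le t v = nb_le r v.
  by move=> tr; rewrite xsE /nb_le; clear -tr; elim: v => //= a v IH; lia.
have xs0 t : r <= t -> nb_gt t xs = 0.
  move=> rt; rewrite xsE; apply/eqP; rewrite -leqn0 leqNgt -has_count.
  by apply/hasPn => x _; lia.
have size_xs : count_mem r.+1 v + size xs = size v.
  rewrite size_rev size_filter.
  by clear -bv; elim: v bv => //= a v IH /andP[ar /IH]; lia.
clearbody xs.
have col i t : i < r -> nb_le t.+1 (row (rcons U v) i.+2) <= nb_le t (nth [::] U i).
  by move=> lt_i; have := @filling_column _ gT i.+1 t isT; rewrite (rU i.+1).
have ri : forall i, i < size U ->
    row_insertion (nth [::] (sweep xs U).2 i.+1) (nth [::] U i)
                  (nth [::] (sweep xs U).1 i) (nth [::] (sweep xs U).2 i).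
  apply: sweep_insertion => // [w wU|i t lt_i|t].
  - have <- : row (rcons U v) (index w U).+1 = w.
      by rewrite rU -?rE ?index_mem // /row /= nth_index.
    exact: filling_sorted.
  - by have := @col i t; rewrite (rU i.+2) -rE // ltnW //; apply.
  case: (posnP r) => [r0|r0]; first by rewrite xs0 // r0.
  have := @col r.-1 t; rewrite prednK // rv -rE nth_last rE => /(_ (leqnn _)).
  move/(leq_add (leqnn (nb_gt t.+1 xs))); apply: leq_trans.
  have := xs_le 0 (leq0n _); case: (leqP t.+1 r) => tr.
    have := xs_le _ tr; lia.
  have := nb_le_homo v (ltnW tr); lia.
have [cs1 yss_size yssE] := climbs_sweep xs U.
have [sz1 yss_last] := sweep_last xs U.
have memc cs : cs \in (climbs xs U).2 -> _ := @climbs_mem xs U cs.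
have szc := size_climbs xs U.
case: sweep ri cs1 yss_size yssE sz1 yss_last => U' yss /= ri.
case: climbs szc memc => _ css /= szc memc -> yss_size yssE sz1 yss_last.
set ks := _ ++ _.
have syss i : i <= r -> sorted geq (nth [::] yss i).
  rewrite leq_eqVlt => /orP[/eqP->|lt_i]; first by rewrite -rE yss_last.
  by apply: ri_out_sorted (ri i _); rewrite rE.
exists (fun t i => nb_gt t (nth [::] yss i.-1)).
have rir i : 0 < i <= r -> row_insertion (nth [::] yss i)
    (row (rcons U v) i) (row U' i) (nth [::] yss i.-1).
  by case: i => [|i] // /andP[_ lt_i]; rewrite rU //; apply: ri; rewrite rE.
have ksc t : t <= r -> nb_le t (map (count_mem 0) css) = nb_gt 0 (nth [::] yss t).
  move=> le_t; rewrite yssE ?rE // /nb_le /nb_gt !count_map.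
  by apply: eq_in_count => cs /memc[szs /count0_leq] /= ->; rewrite ?szs ?rE.
have le_ks : all (leq^~ r.+1) (map (count_mem 0) css).
  rewrite all_map; apply/allP => cs /memc [+ _] /=.
  by rewrite rE => <-; apply: count_size.
split=> /=.
- by rewrite size_rcons rE.
- by rewrite sz1.
- by move=> i /rir/ri_size.
- move=> i; case: (posnP i) => [->|i0] //.
  case: (leqP i r) => ir; first by apply: ri_sorted (rir i _); rewrite i0.
  by rewrite /row; case: i i0 ir => // i _ ir; rewrite /= nth_default // sz1 rE.
- by move=> i t; apply: sub_count => x /=; apply: ltnW.
- by move=> i t ir; apply: ri_le (rir i ir) t.
- by move=> i t ir; apply: ri_conserve (rir i ir) t.
- by move=> i t ir; apply: ri_min (rir i ir) t.
- by move=> t tr; rewrite rv -rE yss_last rE xs_le.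
- by move=> t tr; rewrite -rE yss_last xs0.
- by rewrite rv /ks size_cat size_nseq size_map szc size_xs.
- rewrite (sorted_pairwise leq_trans) pairwise_cat; apply/and3P; split.
  + by apply/allrelP => x y; rewrite mem_nseq => /andP[_ /eqP->].
  + elim: (count_mem _ _) => //= m ->; rewrite andbT; apply/allP => x.
    by rewrite mem_nseq => /andP[_ /eqP->].
  rewrite -(sorted_pairwise leq_trans); apply/(sortedP 0) => p.
  rewrite size_map => lt_p; rewrite !(nth_map [::]) //; last exact: ltnW.
  set c1 := nth _ _ p; set c2 := nth _ _ p.+1.
  have [sz_1 tz1] := memc c1 (mem_nth _ (ltnW lt_p)).
  have [sz_2 tz2] := memc c2 (mem_nth _ lt_p).
  case: (leqP (size c2) (count_mem 0 c2)) => [|lt_c].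
    by apply: leq_trans; rewrite sz_2 -sz_1 count_size.
  rewrite count0_leq //; last by rewrite sz_1 -sz_2.
  have : 0 < nth 0 c2 (count_mem 0 c2) by rewrite -count0_leq.
  move/leq_trans; apply.
  have le_t : count_mem 0 c2 <= r by rewrite -ltnS -rE -sz_2.
  have /(sortedP 0)/(_ p) := syss _ le_t.
  by rewrite yssE ?rE // size_map !(nth_map [::]) //; [apply|apply: ltnW].
- rewrite all_cat le_ks andbT; apply/allP => x.
  by rewrite mem_nseq => /andP[_ /eqP->].
- move=> t tr; rewrite rv /nb_le count_cat -!/(nb_le _ _) ksc //; congr (_ + _).
  by rewrite /nb_le count_nseq mul1n.
Qed.

Lemma nb_le_full t w : all (fun x => x <= t) w -> nb_le t w = size w.
Proof. by rewrite -nb_le_all => /eqP. Qed.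

Lemma nb_le_size t w : nb_le t w <= size w.
Proof. exact: count_size. Qed.

Lemma nb_eq_bound b s w : all (fun x => x <= b) w -> b < s -> nb_eq s w = 0.
Proof.
move=> bw bs; apply/eqP; rewrite -leqn0 leqNgt -has_count; apply/hasPn => x.
by move=> /(allP bw) le_x; rewrite /= ltn_eqF // (leq_ltn_trans le_x).
Qed.

Lemma row_default T i : size T < i -> row T i = [::].
Proof. by case: i => // i lt_i; rewrite /row /= nth_default. Qed.

Lemma nb_inS T s i : nb_in T s i.+1 = nb_in T s i + nb_eq s (row T i.+1).
Proof.
rewrite /nb_in; case: (ltnP i (size T)) => [lt_i|le_i].
  by rewrite (take_nth [::]) // flatten_rcons count_cat.
by rewrite row_default // !take_oversize ?(leqW le_i) // addn0.
Qed.

Lemma nb_in0 T s : nb_in T s 0 = 0.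
Proof. by rewrite /nb_in take0. Qed.

Lemma nb_in_homo T s i j : i <= j -> nb_in T s i <= nb_in T s j.
Proof. by move/subnK<-; elim: (j - i) => // k IH; rewrite addSn nb_inS; lia. Qed.

Lemma nb_in_oversize T s i : size T <= i -> nb_in T s i = nb_in T s (size T).
Proof. by move=> le_i; rewrite /nb_in !take_oversize. Qed.

Lemma filling_full T i t : LR_filling T -> i <= t -> nb_le t (row T i) = size (row T i).
Proof.
move=> gT it; apply: nb_le_full; apply: sub_all (filling_bound gT i) => x /= xi.
exact: leq_trans xi it.
Qed.

Lemma filling_size T i : LR_filling T -> 0 < i -> size (row T i.+1) <= size (row T i).
Proof.
move=> gT i0; have := filling_column gT i i0.
by rewrite (@filling_full T i.+1) // (@filling_full T i).
Qed.

Lemma nb_in_lt T s i : LR_filling T -> i < s -> nb_in T s i = 0.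
Proof.
move=> gT; elim: i => [|i IH] lt_s; first by rewrite nb_in0.
rewrite nb_inS IH ?(ltnW lt_s) // add0n.
exact: nb_eq_bound (filling_bound gT _) lt_s.
Qed.

Section Deletion.
Variables (r : nat) (T T' : tableau) (ks : seq nat) (G : nat -> nat -> nat).
Hypotheses (gT : LR_filling T) (D : deletion r T T' ks G).

Local Notation R t i := (nb_le t (row T i)).
Local Notation R' t i := (nb_le t (row T' i)).

(** An entry that rises by one row decreases by at least one, and the word that
    enters row r has entries at most r. *)
Lemma deletion_tail0 t i : 0 < i <= r.+1 -> i.-1 <= t -> G t i = 0.
Proof.
move=> /andP[i0 ir]; have {ir} := subnKC ir; move: (r.+1 - i) => k.
elim: k i t i0 => [|k IH] i t i0 iE it.
  have -> : i = r.+1 by rewrite -iE addn0.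
  apply: (del_last0 D); lia.
have ir : 0 < i <= r by lia.
have := del_min D t ir; rewrite (IH i.+1 t.+1) //; lia.
Qed.

Lemma deletion_mono t t' i : 0 < i <= r.+1 -> t <= t' ->
  G t i + R t i <= G t' i + R t' i.
Proof.
move=> /andP[i0 ir] tt.
case: (leqP i r) => ir'.
  move/subnK: tt <-; elim: (t' - t) => // k IH; apply: leq_trans IH _.
  have i0r : 0 < i <= r by rewrite i0.
  rewrite addSn (del_min D _ i0r); exact: geq_minl.
have -> : i = r.+1 by lia.
case: (leqP t' r) => tr.
  by rewrite !(del_last D) // (leq_trans tt).
rewrite [X in _ <= X + _](del_last0 D) ?(ltnW tr) // add0n.
case: (leqP t r) => tr'.
  by rewrite (del_last D) //; apply: nb_le_homo; apply: ltnW.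
by rewrite (del_last0 D) ?(ltnW tr') // nb_le_homo.
Qed.

(** Downward induction on s.  If all the entries s+1 of row i are replaced, those
    that it has afterwards come from row i+1, and the claim for s+1 gives it for
    s.  If not, no entry greater than s+1 is left waiting: row i loses at most as
    many entries at most s as row i+1 has entries s+1, so the claim follows from
    the strict increase down the columns of T. *)
Lemma deletion_interlace s i : 0 < i <= r -> R s i.+1 <= R' s i.
Proof.
move=> ir; have [k] : exists k, i <= s + k by exists i; apply: leq_addl.
elim: k s => [|k IH] s sk; have := del_conserve D s ir.
  rewrite !deletion_tail0; try lia.
  have := filling_column gT s (proj1 (andP ir)).
  have := nb_le_homo (row T i.+1) (leqnSn s); lia.
case: (leqP i s) => si; first by have := IH s; lia.
have := IH s.+1; have := del_conserve D s.+1 ir; have := del_min D s ir.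
have ir1 : 0 < i.+1 <= r.+1 by lia.
have := deletion_mono ir1 (leqnSn s).
have := filling_column gT s (proj1 (andP ir)).
clear -sk; lia.
Qed.

Lemma nb_in_deletion s i : i <= r ->
  nb_in T' s.+1 i + G s.+1 i.+1 = nb_in T s.+1 i + G s i.+1.
Proof.
elim: i => [|i IH] ir; first by rewrite !nb_in0 !deletion_tail0.
have ir1 : 0 < i.+1 <= r by [].
have := IH (ltnW ir); have := del_conserve D s ir1; have := del_conserve D s.+1 ir1.
rewrite !nb_inS !nb_leS; clear; lia.
Qed.

(** For the lattice property: either all the entries s of row i+1 rise to row
    i, or at least as many of them rise to row i as entries s+1 rise to row
    i+1. *)
Lemma deletion_filling : LR_filling T'.
Proof.
have sz := del_size D.
have T'0 i : r < i -> row T' i = [::] by move=> ri; rewrite row_default ?sz.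
have lat s i : 0 < s -> i < r -> nb_in T' s.+1 i.+1 <= nb_in T' s i.
  case: s => // s _ ir.
  have := nb_in_deletion s (ltnW ir); have := nb_in_deletion s.+1 ir.
  have ir1 : 0 < i.+1 <= r by [].
  have ir2 : 0 < i.+2 <= r.+1 by [].
  have := del_min D s ir1; have := deletion_mono ir2 (leqnSn s.+1).
  have := del_min D s.+1 ir1; have := del_le D s.+1 ir1.
  have := filling_lattice gT i.+1 (ltn0Sn s); have := filling_lattice gT i (ltn0Sn s).
  rewrite [nb_in T s.+2 i.+2]nb_inS [nb_in T s.+1 i.+1]nb_inS !nb_leS; clear; lia.
split.
- apply/negP => /(nthP [::])[i]; rewrite sz => lt_i iE.
  have := @del_row_size _ _ _ _ _ D i.+1 lt_i; rewrite {1}/row /= iE => /esym/eqP.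
  rewrite size_eq0 => /eqP iE'; have /negP := filling_nonempty gT; apply.
  by rewrite -iE' /row /=; apply: mem_nth; rewrite (del_source_size D) ltnW.
- exact: del_sorted D.
- move=> i; case: (posnP i) => [->//|i0]; case: (leqP i r) => ir; last by rewrite T'0.
  have i0r : 0 < i <= r by rewrite i0.
  rewrite -nb_le_all (del_row_size D) // -(filling_full gT (leqnn i)).
  have := del_conserve D i i0r; rewrite !deletion_tail0; lia.
- move=> i i0; case: (leqP i r) => ir; last by rewrite T'0 // ltnW.
  have i0r : 0 < i <= r by rewrite i0.
  have := deletion_interlace 0 i0r.
  case: (ltnP i r) => ir'; last by rewrite [row T' i.+1]T'0.
  have i1r : 0 < i.+1 <= r by [].
  have := del_conserve D 0 i1r; have := del_le D 0 i1r; clear; lia.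
- move=> i t i0; case: (ltnP i r) => ir; last by rewrite T'0.
  have i0r : 0 < i <= r by rewrite i0 ltnW.
  have i1r : 0 < i.+1 <= r by [].
  have := deletion_interlace t.+1 i0r.
  have := del_conserve D t i0r; have := del_conserve D t.+1 i0r.
  have := del_conserve D t.+1 i1r; have := del_min D t i0r; have := del_min D t i1r.
  have := filling_column gT t i0; have := del_le D t.+1 i1r; clear; lia.
move=> s i s0; case: (ltnP i r) => ir; first exact: lat.
rewrite nb_inS T'0 //= addn0 [in X in X <= _]nb_in_oversize ?sz //.
case: (posnP r) => [->|r0]; first by rewrite nb_in0.
have := lat s r.-1 s0; rewrite prednK // => /(_ (leqnn _)) h.
by apply: leq_trans h (nb_in_homo _ _ _); lia.
Qed.

Lemma deletion_weight s : 0 < s <= r -> nb_in T' s r = nb_in T s r.+1.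
Proof.
case: s => // s /= sr; have := nb_in_deletion s (leqnn r).
have := del_last D sr; have := del_last D (ltnW sr).
rewrite nb_inS nb_leS; clear; lia.
Qed.

Lemma last_weight : nb_in T r.+1 r.+1 = nb_eq r.+1 (row T r.+1).
Proof. by rewrite nb_inS nb_in_lt. Qed.

Lemma deletion_last_size :
  nb_le r (row T r.+1) + nb_eq r.+1 (row T r.+1) = size (row T r.+1).
Proof. by rewrite -nb_leS filling_full. Qed.

Lemma del_out_full t : r < t -> nb_le t ks = size (row T r.+1).
Proof.
move=> rt; rewrite -(del_out_size D); apply: nb_le_full.
by apply: sub_all (del_out_bound D) => x /leq_trans; apply.
Qed.

(** Each path that ends in row i takes one zero off that row. *)
Lemma deletion_inner i : 0 < i <= r.+1 ->
  nb_le 0 (row T' i) + nb_eq i ks = nb_le 0 (row T i).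
Proof.
case: i => // i /=; rewrite ltnS leq_eqVlt => /orP[/eqP ->|ir].
  have := nb_leS r ks; rewrite (row_default (T := T')) ?(del_size D) //.
  have := del_last D (leq0n r); have := deletion_last_size.
  rewrite del_out_full // (del_out D) // (_ : nb_le 0 [::] = 0) //. clear; lia.
have := nb_leS i ks; rewrite !(del_out D) //; last exact: ltnW.
have i1r : 0 < i.+1 <= r by [].
have := del_conserve D 0 i1r; clear; lia.
Qed.

Lemma del_out0 : nb_le 0 ks = nb_eq r.+1 (row T r.+1).
Proof. by rewrite (del_out D) // deletion_tail0 // addn0. Qed.

(** The mirror image of [del_min]: the entries t+1 that enter row i are those of
    the new row i, or all the entries that are still to be accounted for. *)
Lemma deletion_inverse t i : 0 < i <= r ->
  G t.+1 i.+1 + minn (R' t.+1 i - R' t i) (G t i.+1 - G t i) = G t i.+1.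
Proof.
move=> ir; have := del_conserve D t ir; have := del_conserve D t.+1 ir.
have := del_min D t ir; have := del_le D t ir; have := del_le D t.+1 ir.
have := nb_le_homo (row T i) (leqnSn t); have := del_anti D i.+1 t.
clear; lia.
Qed.

End Deletion.

(** Downward induction on s, comparing the deletion of row r+2 with the next
    one, of row r+1.  In the row i of T1, the entries s+1 include those that
    the first deletion has brought there; the second deletion replaces all of
    them or as many as it needs. *)
Lemma deletion_compare r T T1 T2 ks ks1 G G1 s i :
    LR_filling T ->
    deletion r.+1 T T1 ks G -> deletion r T1 T2 ks1 G1 -> 0 < i <= r.+1 ->
  nb_eq r.+2 (row T r.+2) + G s i.+1
    <= nb_eq r.+1 (row T1 r.+1) + G1 s i.
Proof.
move=> gT D D1.
have gT1 := deletion_filling gT D.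
have nu_le : nb_eq r.+2 (row T r.+2) <= nb_in T r.+1 r.+1.
  by rewrite -last_weight // filling_lattice.
have nu_le' : nb_eq r.+2 (row T r.+2) <= nb_eq r.+1 (row T1 r.+1).
  rewrite -(last_weight _ gT1) (deletion_weight D) ?leqnn //.
  exact: leq_trans nu_le (nb_in_homo _ _ (leqnSn _)).
have [k] : exists k, r < s + k by exists r.+1; apply: leq_addl.
elim: k s i => [|k IH] s i sk ir.
  rewrite (deletion_tail0 D); try lia.
case: (ltnP r s) => rs; first by rewrite (deletion_tail0 D); lia.
case: (ltnP i r.+1) => ir'; last first.
  have -> : i = r.+1 by lia.
  have r1 : 0 < r.+1 <= r.+1 by rewrite leqnn.
  have r2 : 0 < r.+1 <= r.+2 by rewrite leqnSn.
  have := del_last D1 rs; have := deletion_last_size r gT1.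
  have := del_conserve D s r1; have := deletion_mono D r2 rs.
  have := del_row_size D r1; have := deletion_last_size r gT.
  have := deletion_tail0 D r2 (leqnn r); have := last_weight r gT.
  by move: nu_le; clear; lia.
have iro : 0 < i <= r by lia.
have i1r : 0 < i.+1 <= r.+1 by lia.
have i2 : 0 < i <= r.+2 by lia.
have := IH s.+1 i; have := IH s.+1 i.+1; have := del_min D s i1r.
have := del_min D1 s iro; have := del_conserve D s ir; have := del_conserve D s.+1 ir.
have := deletion_mono D i2 (leqnSn s).
move: ir i1r sk; clear; lia.
Qed.

Lemma deletion_column r T T1 T2 ks ks1 G G1 t :
    LR_filling T ->
    deletion r.+1 T T1 ks G -> deletion r T1 T2 ks1 G1 ->
  nb_le t.+1 ks <= nb_le t ks1.
Proof.
move=> gT D D1; case: (leqP t r) => tr.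
  rewrite (del_out D) // (del_out D1) //.
  exact: (deletion_compare 0 gT D D1).
apply: leq_trans (nb_le_size _ _) _.
rewrite (del_out_full D1) // (del_out_size D) (del_row_size D) ?leqnn //.
exact: filling_size.
Qed.

Lemma deletion_inner_column r T T1 T2 ks ks1 G G1 :
    LR_filling T ->
    deletion r.+1 T T1 ks G -> deletion r T1 T2 ks1 G1 ->
  nb_le 0 ks <= nb_le 0 ks1.
Proof.
move=> gT D D1; rewrite (del_out0 D) (del_out0 D1).
rewrite -(last_weight _ gT) -(last_weight _ (deletion_filling gT D)).
rewrite (deletion_weight D) ?leqnn //.
apply: leq_trans (filling_lattice gT _ _) _ => //.
exact: nb_in_homo.
Qed.

Lemma sorted_nb_le_inj u v : sorted leq u -> sorted leq v ->
  (forall t, nb_le t u = nb_le t v) -> u = v.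
Proof.
move=> su sv e; apply: (sorted_eq leq_trans anti_leq) => //.
apply/allP => x _; apply/eqP; change (nb_eq x u = nb_eq x v).
case: x => [|t]; first by rewrite -!nb_le0.
by apply: (@addnI (nb_le t u)); rewrite -nb_leS [in RHS]e -nb_leS.
Qed.

(** The terminating row numbers give G 0, the recurrence solved backwards gives
    G t for increasing t, and the counts of T' then give those of T. *)
Lemma deletion_inj r T1 T2 T' ks G1 G2 :
  LR_filling T1 -> LR_filling T2 ->
  deletion r T1 T' ks G1 -> deletion r T2 T' ks G2 -> T1 = T2.
Proof.
move=> gT1 gT2 D1 D2.
have sz1 := del_source_size D1; have sz2 := del_source_size D2.
have nuE : nb_eq r.+1 (row T1 r.+1) = nb_eq r.+1 (row T2 r.+1).
  by rewrite -(del_out0 D1) (del_out0 D2).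
have szE : size (row T1 r.+1) = size (row T2 r.+1).
  by rewrite -(del_out_size D1) (del_out_size D2).
have GE t i : 0 < i <= r.+1 -> G1 t i = G2 t i.
  elim: t i => [|t IH] i ir.
    case: i ir => // i ir; apply: (@addnI (nb_eq r.+1 (row T1 r.+1))).
    by rewrite -(del_out D1) // (del_out D2) // nuE.
  case: i ir => // -[|i] ir.
    by rewrite (deletion_tail0 D1) // (deletion_tail0 D2).
  have i1r : 0 < i.+1 <= r by lia.
  have := deletion_inverse D1 t i1r; have := deletion_inverse D2 t i1r.
  rewrite !IH; [clear; lia|lia|lia].
apply: (@eq_from_nth _ [::]); first by rewrite sz2.
move=> i; rewrite sz1 => ir; rewrite -[LHS]/(row T1 i.+1) -[RHS]/(row T2 i.+1).
apply: sorted_nb_le_inj; [exact: filling_sorted|exact: filling_sorted|move=> t].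
case: (ltnP i r) => ir'.
  have i1r : 0 < i.+1 <= r by [].
  have i2 : 0 < i.+1 <= r.+1 by lia.
  have i3 : 0 < i.+2 <= r.+1 by lia.
  have := del_conserve D1 t i1r; have := del_conserve D2 t i1r.
  rewrite (GE t _ i2) (GE t _ i3); clear; lia.
have -> : i = r by lia.
case: (leqP t r) => tr; last by rewrite !filling_full.
have := del_last D1 tr; have := del_last D2 tr.
have := deletion_last_size r gT1; have := deletion_last_size r gT2.
rewrite GE ?leqnn //; move: nuE szE; clear; lia.
Qed.

(** * The partner of a filling *)

Lemma nb_in_rcons U v s i : nb_in (rcons U v) s i =
  if i <= size U then nb_in U s i else nb_in U s (size U) + nb_eq s v.
Proof.
rewrite /nb_in -cats1 take_cat ltn_neqAle; case: (leqP i (size U)) => [le_i|lt_i].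
  case: eqP => //= ->.
  by rewrite subnn take0 cats0 take_size.
rewrite andbF take_oversize /= ?subn_gt0 //.
by rewrite flatten_cat count_cat /= cats0 take_size.
Qed.

Lemma filling_rcons U v : LR_filling U -> v != [::] -> sorted leq v ->
  all (fun x => x <= (size U).+1) v ->
  (0 < size U -> nb_le 0 v <= nb_le 0 (row U (size U))) ->
  (forall t, 0 < size U -> nb_le t.+1 v <= nb_le t (row U (size U))) ->
  (forall s, 0 < s -> nb_in U s.+1 (size U) + nb_eq s.+1 v <= nb_in U s (size U)) ->
  LR_filling (rcons U v).
Proof.
move=> gU v0 sv bv iv cv lv.
have rowE i : row (rcons U v) i =
    if i <= size U then row U i else if i == (size U).+1 then v else [::].
  exact: row_rcons.
split.
- by rewrite mem_rcons inE negb_or eq_sym v0 (filling_nonempty gU).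
- by move=> i; rewrite rowE; do 2?case: ifP => // _; apply: filling_sorted.
- move=> i; rewrite rowE; case: ifP => _; first exact: filling_bound.
  by case: eqP => // ->.
- move=> i i0; rewrite !rowE; case: (ltnP i (size U)) => lt_i.
    by rewrite (ltnW lt_i); apply: filling_inner.
  by rewrite eqSS; case: eqP => // iE; rewrite iE leqnn; apply: iv; rewrite -iE.
- move=> i t i0; rewrite !rowE; case: (ltnP i (size U)) => lt_i.
    by rewrite (ltnW lt_i); apply: filling_column.
  by rewrite eqSS; case: eqP => // iE; rewrite iE leqnn; apply: cv; rewrite -iE.
move=> s i s0; rewrite !nb_in_rcons; case: (ltnP i (size U)) => lt_i.
  by rewrite (ltnW lt_i); apply: filling_lattice.
apply: leq_trans (lv s s0) _; case: ifP => _; last exact: leq_addr.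
exact: nb_in_homo.
Qed.

Lemma size_partner_rows r T : size (partner_rows r T) = r.
Proof. by elim: r T => //= r IH T; case: delta => T' w; rewrite size_rcons IH. Qed.

Lemma partner_rowsS r T :
  partner_rows r.+1 T = rcons (partner_rows r (delta r.+1 T).1) (delta r.+1 T).2.
Proof. by rewrite /=; case: delta. Qed.

(** Row r+1 of the partner is added by the deletion of row r+1, while the rows
    above form the partner of the outcome.  The deletions end with the empty
    tableau, so the paths that end in row k are as many as the zeros of that row
    of T; likewise every entry i of T is at last removed as the entry i of
    row i, which records a zero in row i of the partner. *)
Lemma partner_rows_filling r T : LR_filling T -> size T = r ->
  [/\ LR_filling (partner_rows r T),
      forall i, size (row (partner_rows r T) i) = size (row T i),
      forall i, 0 < i -> nb_le 0 (row (partner_rows r T) i) = nb_in T i r &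
      forall k, 0 < k -> nb_in (partner_rows r T) k r = nb_le 0 (row T k)].
Proof.
elim: r T => [|r IH] T gT szT.
  have -> : T = [::] by apply/nilP; rewrite /nilp szT.
  have row0 i : row [::] i = [::] by case: i => [|[|i]].
  split; last by move=> k _; rewrite row0.
  - split=> // [i|i|i _|i t _]; by rewrite ?row0.
  - by [].
  by move=> i _; rewrite row0.
have [G D] := deltaP gT szT; rewrite partner_rowsS.
case: (delta r.+1 T) D => T' ks /= D.
have gT' := deletion_filling gT D; have szT' := del_size D.
have [gS sS iS wS] := IH _ gT' szT'; set S := partner_rows r T' in gS sS iS wS *.
have szS : size S = r by rewrite size_partner_rows.
have rowE i : row (rcons S ks) i =
    if i <= r then row S i else if i == r.+1 then ks else [::].
  by rewrite row_rcons szS.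
have r1 : 0 < r.+1 <= r.+1 by rewrite leqnn.
split.
- apply: filling_rcons => //; rewrite ?szS.
  + apply: contra (filling_nonempty gT); rewrite -size_eq0 (del_out_size D) size_eq0.
    by move=> /eqP <-; rewrite /row /=; apply: mem_nth; rewrite szT.
  + exact: del_out_sorted D.
  + exact: del_out_bound D.
  + rewrite /S => r0; have szT1 : size T' = r.-1.+1 by rewrite prednK.
    have [G1 D1] := deltaP gT' szT1.
    rewrite -(prednK r0) partner_rowsS row_rcons size_partner_rows ltnn eqxx.
    by rewrite -(prednK r0) in D; apply: deletion_inner_column gT D D1.
  + move=> t; rewrite /S => r0; have szT1 : size T' = r.-1.+1 by rewrite prednK.
    have [G1 D1] := deltaP gT' szT1.
    rewrite -(prednK r0) partner_rowsS row_rcons size_partner_rows ltnn eqxx.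
    by rewrite -(prednK r0) in D; apply: deletion_column gT D D1.
  move=> s s0; rewrite !wS //.
  case: (leqP s.+1 r.+1) => sr; last first.
    by rewrite row_default ?szT' ?(ltnW sr) // (nb_eq_bound (del_out_bound D) sr).
  rewrite (deletion_inner gT D) //.
  have [lt_s|le_s] := ltnP s r.+1; last by lia.
  have [lt_s'|] := leqP s r; last lia.
  by apply: (deletion_interlace gT D); rewrite s0.
- move=> i; rewrite rowE; case: (leqP i r) => ir.
    case: (posnP i) => [->//|i0].
    by rewrite sS (del_row_size D) ?i0.
  case: eqP => [->|ne]; first exact: del_out_size D.
  by rewrite row_default // szT ltn_neqAle ir eq_sym andbT; apply/eqP.
- move=> i i0; rewrite rowE; case: (leqP i r) => ir.
    by rewrite iS // (deletion_weight D) // i0.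
  case: eqP => [->|ne]; first by rewrite (del_out0 D) (last_weight r gT).
  by rewrite nb_in_lt // ltn_neqAle ir eq_sym andbT; apply/eqP.
move=> k k0; rewrite nb_in_rcons szS ltnn wS //.
case: (leqP k r.+1) => kr; first by rewrite (deletion_inner gT D) // k0.
rewrite !row_default ?szT ?szT' ?(ltnW kr) //.
by rewrite (nb_eq_bound (del_out_bound D) kr).
Qed.

Lemma partner_rows_inj r T1 T2 : LR_filling T1 -> LR_filling T2 ->
  size T1 = r -> size T2 = r ->
  partner_rows r T1 = partner_rows r T2 -> T1 = T2.
Proof.
elim: r T1 T2 => [|r IH] T1 T2 gT1 gT2 sz1 sz2.
  by move=> _; move/size0nil: sz1 => ->; move/size0nil: sz2 => ->.
have [G1 D1] := deltaP gT1 sz1; have [G2 D2] := deltaP gT2 sz2.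
rewrite !partner_rowsS => /rcons_inj[e1 e2].
have e : (delta r.+1 T1).1 = (delta r.+1 T2).1.
  apply: IH e1; [exact: deletion_filling gT1 D1|exact: deletion_filling gT2 D2|
                 exact: del_size D1|exact: del_size D2].
by rewrite e e2 in D1; apply: deletion_inj gT1 gT2 D1 D2.
Qed.

Lemma partnerE n T : size T <= n -> partner n T = partner_rows (size T) T.
Proof.
move=> le_n; rewrite /partner -(subnKC le_n).
have -> k : partner_rows (size T + k) T = partner_rows (size T) T ++ nseq k [::].
  elim: k => [|k IH]; first by rewrite addn0 cats0.
  rewrite addnS partner_rowsS /delta (ltn_eqF (_ : _ < (_ + k).+1)) ?ltnS ?leq_addr //=.
  by rewrite IH rcons_cat; congr (_ ++ _); elim: k {IH} => //= k ->.
by rewrite take_size_cat // size_partner_rows.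
Qed.

(** * LR tableaux *)

Lemma part_shape T i : part (shape T) i = size (row T i).
Proof.
case: i => // i; rewrite /part /row /=.
case: (ltnP i (size T)) => lt_i; first by rewrite (nth_map [::]).
by rewrite !nth_default // size_map.
Qed.

Lemma part_anti la i : is_part la -> 0 < i -> part la i.+1 <= part la i.
Proof.
case/andP=> + _; case: i => // i /(sortedP 0)/(_ i) h _; rewrite /part /=.
by case: (ltnP i.+1 (size la)) => [/h //|le]; rewrite nth_default.
Qed.

Lemma sorted_nth_le w t k : sorted leq w -> k < size w ->
  (nth 0 w k <= t) = (k < nb_le t w).
Proof.
elim: w k => //= a w IH k sw lt_k; have sw' := path_sorted sw.
rewrite /nb_le /= -/(nb_le t w); case: (leqP a t) => [le_a|lt_a].
  by case: k lt_k => //= k lt_k; rewrite add1n ltnS IH.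
have lt_w : all (fun x => t < x) w.
  move: sw; rewrite (path_sortedE leq_trans) => /andP[+ _].
  by apply: sub_all => x; apply: leq_trans.
rewrite nb_le_none // ltn0 leqNgt; apply/negbF; case: k lt_k => //= k lt_k.
exact: (allP lt_w) (mem_nth _ _).
Qed.

Lemma entry_le T i j t : sorted leq (row T i) -> 0 < j <= size (row T i) ->
  (entry T i j <= t) = (j <= nb_le t (row T i)).
Proof. by case: j => // j si /= js; rewrite /entry /= sorted_nth_le. Qed.

Lemma entry_gt0 T i j : 0 < entry T i j -> 0 < j <= size (row T i).
Proof.
case: j => // j; rewrite /entry /= => h; rewrite ltnNge.
by apply: contraL h => /(nth_default 0) ->.
Qed.

Lemma filling_column_strict T i j : LR_filling T -> 0 < i -> 0 < entry T i.+1 j ->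
  entry T i j < entry T i.+1 j.
Proof.
move=> gT i0 e0; have /andP[j0 js] := entry_gt0 e0.
have js' : j <= size (row T i) by apply: leq_trans js (filling_size gT i0).
case e: (entry T i.+1 j) e0 => [|t] // _; rewrite ltnS.
rewrite entry_le ?j0 //; last exact: filling_sorted.
apply: leq_trans (filling_column gT t i0).
by rewrite -entry_le ?e ?j0 //; apply: filling_sorted.
Qed.

Lemma filling_column_weak T i i' j : LR_filling T ->
  0 < i <= i' -> 0 < j <= size (row T i') ->
  entry T i j <= entry T i' j.
Proof.
move=> gT /andP[i0 /subnK <-]; elim: (i' - i) => // k IH; rewrite addSn => /andP[j0 js].
have ki : 0 < k + i by rewrite addn_gt0 i0 orbT.
have js' : j <= size (row T (k + i)) by apply: leq_trans js (filling_size gT ki).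
apply: leq_trans (IH _) _; first by rewrite j0.
case: (posnP (entry T (k + i).+1 j)) => [e0|/(filling_column_strict gT ki)/ltnW //].
have := filling_inner gT ki; move: (leqnn (entry T (k + i).+1 j)).
rewrite {2}e0 entry_le ?j0 //; last exact: filling_sorted.
by move/leq_trans=> h /h; rewrite -entry_le ?e0 ?j0 //; apply: filling_sorted.
Qed.

Lemma filling_to_LR mu nu T : LR_filling T ->
  (forall i, 0 < i -> nb_le 0 (row T i) = part mu i) ->
  (forall s, 0 < s -> nb_in T s (size T) = part nu s) ->
  LR (shape T) mu nu T.
Proof.
move=> gT iT wT; split.
- split=> // i j; rewrite part_shape; case: (posnP i) => [->|i0 js].
    by rewrite /row /= leqn0 => /andP[] /lt0n_neq0 /negbTE->.
  by rewrite -iT // -leqn0 entry_le //; apply: filling_sorted.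
- by move=> s s0; rewrite -wT // /nb_in take_size.
- split=> [i j j' jj e e'|i i' j ii e e'].
    have /andP[j0 js] := entry_gt0 e; have /andP[j0' js'] := entry_gt0 e'.
    rewrite entry_le ?j0 //; last exact: filling_sorted.
    apply: leq_trans (ltnW jj) _.
    by rewrite -entry_le ?j0' //; apply: filling_sorted.
  have i0 : 0 < i.
    by rewrite lt0n; apply: contraTneq e => ->; rewrite /entry /row; case: (j) => [|[]].
  case: i' ii e' => // i' ii e'.
  have i0' : 0 < i' by apply: leq_trans i0 _; rewrite -ltnS.
  apply: leq_ltn_trans (filling_column_strict gT i0' e').
  have /andP[j0 js] := entry_gt0 e'.
  apply: filling_column_weak => //; first by rewrite i0.
  by rewrite j0 (leq_trans js) // filling_size.
move=> [|r] // [|[|s]] // _ _; exact: (filling_lattice gT r (ltn0Sn s)).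
Qed.

Lemma LR_to_filling la mu nu T : is_part la -> is_part mu -> part_sub mu la ->
  LR la mu nu T ->
  [/\ LR_filling T, shape T = la,
      forall i, 0 < i -> nb_le 0 (row T i) = part mu i &
      forall s, 0 < s -> nb_in T s (size T) = part nu s].
Proof.
move=> la_p mu_p mu_la [[shT inT] wT [rT cT] lT].
have szE i : size (row T i) = part la i by rewrite -part_shape shT.
have sT i : sorted leq (row T i).
  apply/(sortedP 0) => k lt_k.
  case: (posnP (nth 0 (row T i) k)) => [->//|e0].
  have e1 : 0 < entry T i k.+2.
    rewrite lt0n (inT i k.+2) -?szE //; apply: contraL e0 => le_k.
    rewrite -leqNgt leqn0 -[nth _ _ _]/(entry T i k.+1) inT ?(ltnW le_k) //.
    by rewrite -szE; apply: ltnW.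
  exact: (rT i k.+1 k.+2 (ltnSn _) e0 e1).
have iT i : nb_le 0 (row T i) = part mu i.
  have h j : 0 < j <= size (row T i) -> (j <= nb_le 0 (row T i)) = (j <= part mu i).
    by move=> js; rewrite -entry_le // leqn0 inT -?szE.
  have le1 := nb_le_size 0 (row T i); have le2 := mu_la i; rewrite -szE in le2.
  apply/eqP; rewrite eqn_leq; apply/andP; split.
    by case: (posnP (nb_le 0 (row T i))) => [->//|p]; rewrite -h ?p.
  by case: (posnP (part mu i)) => [->//|p]; rewrite h ?p.
have lat s i : 0 < s -> nb_in T s.+1 i.+1 <= nb_in T s i.
  by move=> s0; apply: (lT i.+1 s.+1).
have diag i s : i < s -> nb_in T s i = 0.
  elim: i s => [|i IH] [|s] // lt_is; first by rewrite nb_in0.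
  have s0 : 0 < s by apply: leq_ltn_trans (leq0n i) lt_is.
  by apply/eqP; rewrite -leqn0 -(IH s lt_is) lat.
split=> //; last by move=> s s0; rewrite -wT // /nb_in take_size.
split=> //.
- apply/negP => /(map_f size); rewrite -/(shape T) shT.
  by case/andP: la_p => _ /negP.
- case=> // i; apply/allP => x xi; rewrite leqNgt; apply/negP => /diag.
  rewrite nb_inS => /eqP; rewrite addn_eq0 => /andP[_].
  by rewrite -leqn0 leqNgt -has_count => /hasPn/(_ x xi); rewrite /= eqxx.
- by move=> i i0; rewrite !iT part_anti.
move=> i t i0; set j := nb_le _ _; case: (posnP j) => [-> //|j0].
have js : 0 < j <= size (row T i.+1) by rewrite j0 nb_le_size.
have js' : 0 < j <= size (row T i).
  by rewrite j0 (leq_trans (nb_le_size _ _)) // !szE part_anti.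
rewrite -entry_le //.
have : entry T i.+1 j <= t.+1 by rewrite entry_le.
case: (posnP (entry T i j)) => [->//|e0].
have e1 : 0 < entry T i.+1 j.
  rewrite ltnNge; apply: contraL e0; rewrite entry_le // iT => jm.
  by rewrite -leqNgt entry_le // iT (leq_trans jm) // part_anti.
by move/(leq_trans (cT i i.+1 j (ltnSn i) e0 e1)).
Qed.

(** * The bijection *)

(** A tableau is determined by its shape and its reading word, whose entries are
    at most the number of rows. *)
Lemma LR_finite la mu nu : is_part la -> is_part mu -> part_sub mu la ->
  finite_set (LR la mu nu).
Proof.
move=> la_p mu_p mu_la.
pose f (t : (sumn la).-tuple 'I_(size la).+1) := reshape la (map val t).
apply: (@sub_finite_set _ _ (f @` setT)%classic); last first.
  by apply: finite_image; apply: finite_finset.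
move=> T /(LR_to_filling la_p mu_p mu_la)[gT shT _ _].
have bT : all (fun x => x < (size la).+1) (flatten T).
  apply/allP => x /flattenP[w /(nthP [::])[i lt_i <-] xw].
  rewrite -shT size_map ltnS (leq_trans _ lt_i) //.
  exact: (allP (filling_bound gT i.+1)).
have szT : size [seq inord x : 'I_(size la).+1 | x <- flatten T] == sumn la.
  by rewrite size_map size_flatten shT.
exists (Tuple szT) => //; rewrite /f /= -map_comp.
rewrite map_id_in => [|x /(allP bT) lt_x /=]; last by rewrite inordK.
by rewrite -shT flattenK.
Qed.

(** The composite g \o f is an injection of a finite set into itself, so g b is
    in its image. *)
Lemma finite_inj_surj (X Y : eqType) (A : set X) (B : set Y) f g :
  finite_set A -> set_fun A B f -> set_fun B A g ->
  set_inj A f -> set_inj B g -> set_surj A B f.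
Proof.
move=> /finite_seqP[s AE] fAB gBA fI gI b Bb.
have inA x : A x <-> x \in undup s by rewrite mem_undup AE.
have gfI : {in undup s &, injective (g \o f)}.
  move=> x y /inA Ax /inA Ay /= /gI e; apply: fI; rewrite ?inE //.
  by apply: e; rewrite inE; apply: fAB.
have sub : {subset map (g \o f) (undup s) <= undup s}.
  by move=> _ /mapP[x /inA Ax ->]; apply/inA; apply: gBA; apply: fAB.
have uq : uniq (map (g \o f) (undup s)) by rewrite map_inj_in_uniq ?undup_uniq.
have [_ /(_ (g b))] := uniq_min_size uq sub (eq_leq (esym (size_map _ _))).
have /inA-> := gBA b Bb; case/mapP => x /inA Ax /gI e; exists x => //.
by symmetry; apply: e; rewrite inE //; apply: fAB.
Qed.

Lemma partner_LR n la mu nu : is_part la -> is_part mu -> part_sub mu la ->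
  size la <= n -> set_fun (LR la mu nu) (LR la nu mu) (partner n).
Proof.
move=> la_p mu_p mu_la le_n T /(LR_to_filling la_p mu_p mu_la)[gT shT iT wT].
have szT : size T = size la by rewrite -shT size_map.
rewrite partnerE ?szT //; have [gS sS iS wS] := partner_rows_filling gT szT.
have shS : shape (partner_rows (size la) T) = la.
  apply: (@eq_from_nth _ 0); first by rewrite size_map size_partner_rows.
  move=> i _; rewrite -[LHS]/(part (shape _) i.+1) part_shape sS -part_shape shT.
  by [].
rewrite -{1}shS; apply: filling_to_LR => // [i i0|s s0]; first by rewrite iS // -szT wT.
by rewrite size_partner_rows wS // iT.
Qed.

Lemma partner_inj n la mu nu : is_part la -> is_part mu -> part_sub mu la ->
  size la <= n -> set_inj (LR la mu nu) (partner n).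
Proof.
move=> la_p mu_p mu_la le_n T1 T2; rewrite !inE.
move=> /(LR_to_filling la_p mu_p mu_la)[g1 sh1 _ _].
move=> /(LR_to_filling la_p mu_p mu_la)[g2 sh2 _ _].
have sz1 : size T1 = size la by rewrite -sh1 size_map.
have sz2 : size T2 = size la by rewrite -sh2 size_map.
by rewrite !partnerE ?sz1 ?sz2 //; apply: partner_rows_inj.
Qed.

Theorem theorem4p8 (n : nat) (la mu nu : seq nat)
    (n_gt0 : 0 < n)
    (la_part : is_part la) (mu_part : is_part mu) (nu_part : is_part nu)
    (la_len : size la <= n)
    (mu_la : part_sub mu la) (nu_la : part_sub nu la)
    (la_wt : sumn la = sumn mu + sumn nu) :
  set_bij (LR la mu nu) (LR la nu mu) (partner n).
Proof.
have fun_mu := @partner_LR n la mu nu la_part mu_part mu_la la_len.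
have inj_mu := @partner_inj n la mu nu la_part mu_part mu_la la_len.
split=> //; apply: finite_inj_surj fun_mu _ inj_mu _.
- exact: LR_finite.
- exact: partner_LR.
- exact: partner_inj.
Qed.
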